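(* For every $n$ and every Dyck path $x$ in the Dyck lattice $\mathcal{D}_n$, the Euler characteristic $\chi(x)$ is equal to the number of $1$-tunnels of $x$.
   Context: The Dyck lattice $\mathcal{D}_n$ is the set of Dyck paths of length $2n$ (steps $U=(1,1)$, $D=(1,-1)$, from $(0,0)$ to $(2n,0)$, never going below the $x$-axis), ordered by $x\le y$ iff $x$ lies weakly below $y$. It is a finite distributive lattice with minimum $\widehat0=(UD)^n$. A join-irreducible element is an $x\ne\widehat0$ such that $x=u\vee v$ implies $x=u$ or $x=v$. A $k$-tunnel of a Dyck path $x$ is a horizontal segment, not reduced to a point, on the line $y=k$, lying below the path and meeting $x$ only at its two endpoints; equivalently, $k$-tunnels correspond to factorizations $x=\alpha\,U\,\gamma\,D\,\beta$ where $\gamma$ is a (possibly empty) Dyck path and the displayed $U$ starts at height $k$. A valuation on a finite distributive lattice $L$ is a map $\nu:L\to\mathbb{R}$ with $\nu(\widehat0)=0$ and $\nu(x\vee y)+\nu(x\wedge y)=\nu(x)+\nu(y)$ for all $x,y$. It is uniquely determined by its values on join-irreducibles, which can be assigned arbitrarily. The Euler characteristic $\chi$ of $L$ is the unique valuation with $\chi(x)=1$ for every join-irreducible $x$. *)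

(* Defs.v *)
From HB Require Import structures.
From mathcomp Require Import all_boot all_order all_algebra.
From mathcomp Require Import zify.
From mathcomp Require Import boolp reals.

Set Implicit Arguments.
Unset Strict Implicit.
Unset Printing Implicit Defensive.

Import Order.TTheory GRing.Theory Num.Theory.

Local Open Scope ring_scope.

Section Valuations.
Context {d : Order.disp_t} {L : finTBDistrLatticeType d} {R : realType}.
Implicit Types (x y u v p q : L) (nu : L -> R).
Local Open Scope order_scope.

Definition join_irreducible x : Prop :=
  x != \bot /\ forall u v, x = u `|` v -> x = u \/ x = v.

Definition valuation nu : Prop :=
  nu \bot = 0%R /\
  forall x y, (nu (x `|` y) + nu (x `&` y) = nu x + nu y)%R.

Definition euler_valuation nu : Prop :=
  valuation nu /\ forall x, join_irreducible x -> nu x = 1%R.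

Let rank x := #|[pred y | y <= x]|.

Let rank_lt x y : x < y -> (rank x < rank y)%N.
Proof.
move=> xy; apply: proper_card; apply/properP; split.
  by apply/subsetP => z; rewrite !inE => /le_trans; apply; apply: ltW.
by exists y; rewrite !inE ?lexx //; apply/negP => /(lt_le_trans xy); rewrite ltxx.
Qed.

Lemma join_irreducible_leU p x y :
  join_irreducible p -> (p <= x `|` y) = (p <= x) || (p <= y).
Proof.
move=> [_ irr_p]; apply/idP/orP; last first.
  by case=> h; [apply: lexUl | apply: lexUr].
move=> /meet_idPl; rewrite meetUr => /esym /irr_p [] /esym/meet_idPl h; by [left|right].
Qed.

Let irr x : bool := `[< join_irreducible x >].

Let irrP x : irr x -> join_irreducible x.
Proof. by rewrite /irr => /asboolP. Qed.

Let wsum (w : L -> R) x : R := (\sum_(q | irr q && ((q : L) <= x)%O) w q)%R.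

Let wsum_valuation w : valuation (wsum w).
Proof.
split.
  rewrite /wsum big_pred0 // => q; apply/negP => /andP[/irrP [q0 _]].
  by rewrite lex0; apply/negP.
have E z : wsum w z = (\sum_(q | irr q) if ((q : L) <= z)%O then w q else 0)%R.
  by rewrite /wsum big_mkcondr.
move=> x y; rewrite !E -!big_split; apply: eq_bigr => q /irrP irr_q.
rewrite join_irreducible_leU // lexI.
by case: (q <= x); case: (q <= y); rewrite /= ?addr0 ?add0r.
Qed.

Lemma valuation_exists (f : L -> R) :
  exists2 nu, valuation nu & forall x, join_irreducible x -> nu x = f x.
Proof.
suff H m : exists w, forall p, (rank p <= m)%N -> irr p -> wsum w p = f p.
  have [w hw] := H #|L|; exists (wsum w) => // x /asboolP irr_x.
  by apply: hw => //; apply: max_card.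
elim: m => [|m [w hw]].
  exists (fun=> 0%R) => p; rewrite leqn0 => /eqP /card0_eq /(_ p).
  by rewrite !inE lexx.
exists (fun p => if rank p == m.+1
  then (f p - \sum_(q | irr q && ((q : L) < p)%O) w q)%R else w p) => p.
rewrite leq_eqVlt => /orP[/eqP rp|rp] irr_p; last first.
  rewrite -[RHS]hw //; apply: eq_bigr => q /andP[_ qp].
  suff /ltn_eqF -> : (rank q < m.+1)%N by [].
  move: qp; rewrite le_eqVlt => /orP[/eqP -> //|/rank_lt /ltn_trans]; exact.
rewrite /wsum (bigD1 p) /= ?irr_p ?lexx // rp eqxx.
rewrite [X in (_ + X)%R](_ : _ = (\sum_(q | irr q && ((q : L) < p)%O) w q)%R) ?subrK //.
apply: eq_big => [q|q /andP[/andP[_ qp] qnp]].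
  by rewrite -andbA lt_neqAle [(q != p) && _]andbC.
have /rank_lt : q < p by rewrite lt_neqAle qnp.
by rewrite rp => /ltn_eqF ->.
Qed.

Lemma valuation_unique nu1 nu2 : valuation nu1 -> valuation nu2 ->
  (forall x, join_irreducible x -> nu1 x = nu2 x) -> nu1 =1 nu2.
Proof.
move=> [z1 v1] [z2 v2] eq12 x.
have [m] := ubnP (rank x); elim: m x => // m IH x; rewrite ltnS => rx.
have lt_eq y : y < x -> nu1 y = nu2 y.
  by move=> yx; apply: IH; apply: leq_trans (rank_lt yx) rx.
have [->|x0] := eqVneq x \bot; first by rewrite z1 z2.
have [/eq12//|nirr] := pselect (join_irreducible x).
have [u [v [xE xu xv]]] : exists u v, [/\ x = u `|` v, x <> u & x <> v].
  apply: contrapT => H; apply: nirr; split=> // u v xE.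
  apply: contrapT => /not_orP[xu xv]; apply: H; by exists u, v.
have ux : u < x by rewrite lt_neqAle eq_sym; apply/andP; split; [apply/eqP|rewrite xE leUl].
have vx : v < x by rewrite lt_neqAle eq_sym; apply/andP; split; [apply/eqP|rewrite xE leUr].
have ix : u `&` v < x by apply: le_lt_trans ux; apply: leIl.
apply: (addIr (nu1 (u `&` v))); rewrite {2}(lt_eq _ ix) xE v1 v2.
by rewrite (lt_eq _ ux) (lt_eq _ vx).
Qed.

Lemma euler_valuation_exists : exists nu, euler_valuation nu.
Proof. by have [nu ? ?] := valuation_exists (fun=> 1%R); exists nu; split. Qed.

End Valuations.

(* The Euler characteristic of L, that is the unique valuation that is 1 on
   the join-irreducible elements (see [euler_charP], [euler_char_unique]). *)
Definition euler_char (R : realType) {d : Order.disp_t}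
    {L : finTBDistrLatticeType d} : L -> R :=
  sval (cid (@euler_valuation_exists d L R)).

Lemma euler_charP (R : realType) d (L : finTBDistrLatticeType d) :
  euler_valuation (@euler_char R d L).
Proof. exact: svalP. Qed.

Lemma euler_char_unique (R : realType) d (L : finTBDistrLatticeType d)
    (nu : L -> R) : euler_valuation nu -> nu =1 euler_char R.
Proof.
move=> [v1 h1]; have [v2 h2] := @euler_charP R d L.
by apply: valuation_unique => // x jx; rewrite h1 ?h2.
Qed.

(* A path is a sequence of steps, [true] standing for U = (1,1) and [false]
   for D = (1,-1); [height s i] is its ordinate at abscissa [i]. *)
Definition step (b : bool) : int := if b then 1 else -1.

Definition height (s : seq bool) (i : nat) : int := \sum_(b <- take i s) step b.

Definition is_dyck n (s : (n.*2).-tuple bool) : bool :=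
  [forall i : 'I_(n.*2).+1, 0 <= height s i] && (height s n.*2 == 0).

Record dyck n := Dyck { dyck_val :> (n.*2).-tuple bool; _ : is_dyck dyck_val }.

HB.instance Definition _ n := [isSub for @dyck_val n].
HB.instance Definition _ n := [Finite of dyck n by <:].

Section Height.
Implicit Types (s : seq bool) (i : nat).

Lemma height0 s : height s 0 = 0.
Proof. by rewrite /height take0 big_nil. Qed.

Lemma heightS s i : (i < size s)%N ->
  height s i.+1 = height s i + step (nth false s i).
Proof. by move=> lt_is; rewrite /height (take_nth false) // big_rcons. Qed.

Lemma height_parity s i : (i <= size s)%N ->
  exists2 m : nat, (m <= i)%N & height s i = i%:Z - (m.*2)%:Z.
Proof.
elim: i => [|i IH] lt_is; first by exists 0%N; rewrite // height0.
have [m le_mi E] := IH (ltnW lt_is); rewrite heightS // E /step.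
by case: (nth _ _ _); [exists m | exists m.+1] => /=; lia.
Qed.

Lemma height_inj n (s t : n.-tuple bool) :
  (forall i, (i <= n)%N -> height s i = height t i) -> s = t.
Proof.
move=> E; apply: val_inj; apply: (@eq_from_nth _ false); first by rewrite !size_tuple.
rewrite size_tuple => i lt_in.
have := E _ lt_in; rewrite !heightS ?size_tuple // E ?(ltnW lt_in) //.
by move/addrI; rewrite /step; do 2!case: (nth _ _ _).
Qed.

End Height.

Section DyckLattice.
Context {n : nat}.
Implicit Types (x y z : dyck n) (i : nat) (h : nat -> int).

Lemma dyck_ge0 x i : (i <= n.*2)%N -> 0 <= height x i.
Proof.
have /andP[/forallP hx _] := valP x.
by rewrite -ltnS => lt_i; apply: (hx (Ordinal lt_i)).
Qed.

Lemma dyck_end x : height x n.*2 = 0.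
Proof. by have /andP[_ /eqP] := valP x. Qed.

Lemma dyck_inj x y :
  (forall i, (i <= n.*2)%N -> height x i = height y i) -> x = y.
Proof. by move=> E; apply: val_inj; apply: height_inj. Qed.

Definition steps_of h : (n.*2).-tuple bool := [tuple h i < h i.+1 | i < n.*2].

Definition dyck_profile h : Prop :=
  [/\ h 0%N = 0, h n.*2 = 0, forall i, (i <= n.*2)%N -> 0 <= h i &
      forall i, (i < n.*2)%N -> h i.+1 = h i + 1 \/ h i.+1 = h i - 1].

Lemma height_steps_of h i : dyck_profile h -> (i <= n.*2)%N ->
  height (steps_of h) i = h i.
Proof.
move=> [h0 _ _ hS]; elim: i => [|i IH] le_in; first by rewrite height0.
rewrite heightS ?size_tuple // IH; last exact: ltnW.
rewrite -[i in nth _ _ i]/(val (Ordinal le_in)) -tnth_nth tnth_mktuple /= /step.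
by case: (hS _ le_in) => ->; case: ifP; lia.
Qed.

Lemma is_dyck_steps_of h : dyck_profile h -> is_dyck (steps_of h).
Proof.
move=> hh; have [_ hE h_ge0 _] := hh; apply/andP; split; last first.
  by rewrite height_steps_of // hE.
by apply/forallP => -[i /= lt_i]; rewrite height_steps_of // h_ge0.
Qed.

Lemma profile_op (op : int -> int -> int) x y :
  (op = Num.max \/ op = Num.min) ->
  dyck_profile (fun i => op (height x i) (height y i)).
Proof.
move=> opE; split.
- by rewrite !height0; case: opE => ->; lia.
- by rewrite !dyck_end; case: opE => ->; lia.
- by move=> i le_i; have := dyck_ge0 x le_i; have := dyck_ge0 y le_i;
    case: opE => ->; lia.
move=> i lt_i; have le_i := ltnW lt_i.
rewrite !heightS ?size_tuple //.
have [] := @height_parity x i; rewrite ?size_tuple // => a _ ->.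
have [] := @height_parity y i; rewrite ?size_tuple // => b _ ->.
by rewrite /step; case: opE => ->; do 2!case: (nth _ _ _); lia.
Qed.

Definition dyck_join x y : dyck n :=
  Dyck (is_dyck_steps_of (profile_op x y (or_introl erefl))).
Definition dyck_meet x y : dyck n :=
  Dyck (is_dyck_steps_of (profile_op x y (or_intror erefl))).

Lemma height_join x y i : (i <= n.*2)%N ->
  height (dyck_join x y) i = Num.max (height x i) (height y i).
Proof. by move=> ?; apply: (height_steps_of (profile_op x y (or_introl erefl))). Qed.

Lemma height_meet x y i : (i <= n.*2)%N ->
  height (dyck_meet x y) i = Num.min (height x i) (height y i).
Proof. by move=> ?; apply: (height_steps_of (profile_op x y (or_intror erefl))). Qed.

Definition dyck_le x y : bool :=
  [forall i : 'I_(n.*2).+1, height x i <= height y i].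
Definition dyck_lt x y : bool := (y != x) && dyck_le x y.

Lemma dyck_leP x y :
  reflect (forall i, (i <= n.*2)%N -> height x i <= height y i) (dyck_le x y).
Proof.
apply: (iffP forallP) => [H i|H [i lt_i]]; last exact: H.
by rewrite -ltnS => lt_i; apply: (H (Ordinal lt_i)).
Qed.

Fact dyck_le_def x y : dyck_le x y = (dyck_meet x y == x).
Proof.
apply/dyck_leP/eqP => [le_xy|E i le_i].
  by apply: dyck_inj => i le_i; rewrite height_meet // min_l // le_xy.
by rewrite -E height_meet // ge_min lexx orbT.
Qed.

Fact dyck_meetC : commutative dyck_meet.
Proof. by move=> x y; apply: dyck_inj => i ?; rewrite !height_meet // minC. Qed.
Fact dyck_joinC : commutative dyck_join.
Proof. by move=> x y; apply: dyck_inj => i ?; rewrite !height_join // maxC. Qed.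
Fact dyck_meetA : associative dyck_meet.
Proof. by move=> x y z; apply: dyck_inj => i ?; rewrite !height_meet // minA. Qed.
Fact dyck_joinA : associative dyck_join.
Proof. by move=> x y z; apply: dyck_inj => i ?; rewrite !height_join // maxA. Qed.
Fact dyck_joinKI y x : dyck_meet x (dyck_join x y) = x.
Proof. by apply: dyck_inj => i ?; rewrite height_meet ?height_join //; lia. Qed.
Fact dyck_meetKU y x : dyck_join x (dyck_meet x y) = x.
Proof. by apply: dyck_inj => i ?; rewrite height_join ?height_meet //; lia. Qed.
Fact dyck_meetUl : left_distributive dyck_meet dyck_join.
Proof.
by move=> x y z; apply: dyck_inj => i ?; rewrite !(height_meet, height_join) //; lia.
Qed.
Fact dyck_meetxx : idempotent_op dyck_meet.
Proof. by move=> x; apply: dyck_inj => i ?; rewrite height_meet // minxx. Qed.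

(* The bottom element (UD)^n and the top element U^n D^n. *)
Definition zigzag : (n.*2).-tuple bool := [tuple ~~ odd i | i < n.*2].
Definition peak : (n.*2).-tuple bool := [tuple (i < n)%N | i < n.*2].

Lemma height_zigzag i : (i <= n.*2)%N -> height zigzag i = (odd i)%:Z.
Proof.
elim: i => [|i IH] le_i; first by rewrite height0.
rewrite heightS ?size_tuple // IH; last exact: ltnW.
rewrite -[i in nth _ _ i]/(val (Ordinal le_i)) -tnth_nth tnth_mktuple /= /step.
by case: (odd _).
Qed.

Lemma height_peak i : (i <= n.*2)%N ->
  height peak i = Num.min i%:Z ((n.*2)%:Z - i%:Z).
Proof.
elim: i => [|i IH] le_i; first by rewrite height0; lia.
rewrite heightS ?size_tuple // IH; last exact: ltnW.
rewrite -[i in nth _ _ i]/(val (Ordinal le_i)) -tnth_nth tnth_mktuple /= /step.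
by case: ltnP; lia.
Qed.

Fact is_dyck_zigzag : is_dyck zigzag.
Proof.
apply/andP; split; last by rewrite height_zigzag // odd_double.
by apply/forallP => -[i /= lt_i]; rewrite height_zigzag.
Qed.

Fact is_dyck_peak : is_dyck peak.
Proof.
apply/andP; split; last by rewrite height_peak //; lia.
by apply/forallP => -[i /= lt_i]; rewrite height_peak //; lia.
Qed.

Definition dyck_bot : dyck n := Dyck is_dyck_zigzag.
Definition dyck_top : dyck n := Dyck is_dyck_peak.

Fact dyck_le0x x : dyck_le dyck_bot x.
Proof.
apply/dyck_leP => i le_i; rewrite height_zigzag //.
have := dyck_ge0 x le_i.
have [] := @height_parity x i; rewrite ?size_tuple // => m _ ->; lia.
Qed.

Fact dyck_lex1 x : dyck_le x dyck_top.
Proof.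
have ub i : (i <= n.*2)%N -> height x i <= i%:Z.
  by move=> ?; have [] := @height_parity x i; rewrite ?size_tuple // => m _ ->; lia.
have lb k : (k <= n.*2)%N -> height x (n.*2 - k) <= k%:Z.
  elim: k => [|k IH] le_k; first by rewrite subn0 dyck_end.
  have := IH (ltnW le_k); rewrite -(subnSK le_k) heightS ?size_tuple; last lia.
  by rewrite /step; case: (nth _ _ _); lia.
apply/dyck_leP => i le_i; rewrite height_peak //.
have := ub _ le_i; have := lb (n.*2 - i)%N (leq_subr _ _).
by rewrite subKn //; lia.
Qed.

End DyckLattice.

Fact dyck_display : Order.disp_t. Proof. exact: Order.Disp tt tt. Qed.

HB.instance Definition _ n := Order.isMeetJoinDistrLattice.Build dyck_display
  (dyck n) (@dyck_le_def n) (fun _ _ => erefl) (@dyck_meetC n) (@dyck_joinC n)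
  (@dyck_meetA n) (@dyck_joinA n) (@dyck_joinKI n) (@dyck_meetKU n)
  (@dyck_meetUl n) (@dyck_meetxx n).
HB.instance Definition _ n :=
  Order.hasBottom.Build dyck_display (dyck n) (@dyck_le0x n).
HB.instance Definition _ n :=
  Order.hasTop.Build dyck_display (dyck n) (@dyck_lex1 n).

(* The tunnels of [x] on the line y = k: the pair (i, j) encodes the horizontal
   segment from (i, k) to (j, k). Its endpoints lie on the path and the path is
   strictly above it in between; since steps are +1 or -1 and k is an integer,
   it suffices to look at integer abscissas. *)
Definition tunnels n (k : int) (x : dyck n) :
    {set 'I_(n.*2).+1 * 'I_(n.*2).+1} :=
  [set ij : 'I_(n.*2).+1 * 'I_(n.*2).+1 |
     [&& (ij.1 < ij.2)%N, height x ij.1 == k, height x ij.2 == k &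
         [forall l : 'I_(n.*2).+1, (ij.1 < l < ij.2)%N ==> (k < height x l)]]].

(* Main.v *)
Require Import Defs.
From mathcomp Require Import all_boot all_order all_algebra reals.
From mathcomp Require Import zify.
Import Order.TTheory GRing.Theory.
Local Open Scope ring_scope.

(* A k-tunnel is determined by its left endpoint, which is the start of an up
   step from height k to height k + 1; conversely the first return to height k
   closes a tunnel. For two Dyck paths x and y, heights at the same abscissa
   have the same parity, so above each unit interval the steps of the join and
   of the meet are, up to order, those of x and y: counting up steps that start
   at height k is therefore a valuation when k > 0. If x has two up steps
   starting at height 1, cutting x at the second one and completing both pieces
   by the zigzag path writes x as the join of two strictly smaller paths; hence
   a join-irreducible path has exactly one 1-tunnel. *)

Section UpSteps.
Context {n : nat}.
Implicit Types (x y : dyck n) (i j : 'I_(n.*2).+1) (k : int).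

Lemma dyck_heightS x (i : nat) : (i < n.*2)%N ->
  height x i.+1 = height x i + 1 \/ height x i.+1 = height x i - 1.
Proof.
move=> lt_i; rewrite heightS ?size_tuple // /step.
by case: (nth _ _ _); [left | right].
Qed.

Lemma dyck_parity x (i : nat) : (i <= n.*2)%N ->
  exists m : nat, height x i = i%:Z - (m.*2)%:Z.
Proof. by move=> le_i; have [|m] := @height_parity x i; [rewrite size_tuple | exists m]. Qed.

(** Indexed by the same ordinals as tunnel endpoints, so that [fst] sends tunnels to up steps. *)
Definition upsteps k x : {set 'I_(n.*2).+1} :=
  [set i : 'I_(n.*2).+1 |
     [&& (i < n.*2)%N, height x i == k & height x i.+1 == k + 1]].

Lemma upstepsP k x i :
  reflect [/\ (i < n.*2)%N, height x i = k & height x i.+1 = k + 1]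
          (i \in upsteps k x).
Proof. by rewrite inE; apply: (iffP and3P) => [[? /eqP ? /eqP ?]|[? -> ->]]. Qed.

Lemma tunnelsP k x (ij : 'I_(n.*2).+1 * 'I_(n.*2).+1) :
  reflect [/\ (ij.1 < ij.2)%N, height x ij.1 = k, height x ij.2 = k &
             forall l : nat, (ij.1 < l < ij.2)%N -> k < height x l]
          (ij \in tunnels k x).
Proof.
rewrite inE; apply: (iffP and4P) => [[? /eqP ? /eqP ? /forallP H]|[? -> -> H]]; split=> //.
  move=> l lt_l; have ltl : (l < (n.*2).+1)%N.
    by have := ltn_ord ij.2; lia.
  by have /implyP := H (Ordinal ltl); apply.
by apply/forallP => l; apply/implyP; apply: H.
Qed.

Lemma first_return k x i : i \in upsteps k x ->
  exists j, (i, j) \in tunnels k x.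
Proof.
move=> /upstepsP [lt_i hi hi1].
have ex_ret : exists j : nat, [&& (i < j)%N, (j <= n.*2)%N & height x j <= k].
  (* The path ends at height 0, which is at most [k = height x i]. *)
  exists n.*2; rewrite lt_i leqnn dyck_end -hi; apply: dyck_ge0; exact: ltnW.
case: (ex_minnP ex_ret) => j /and3P[lt_ij le_j hj] min_j.
have above (l : nat) : (i < l < j)%N -> k < height x l.
  move=> /andP[lt_il lt_lj]; rewrite ltNge; apply/negP => hl.
  by have := min_j l; rewrite lt_il hl (leq_trans (ltnW lt_lj) le_j) => /(_ isT); lia.
have ltj : (j < (n.*2).+1)%N by [].
exists (Ordinal ltj); apply/tunnelsP; split=> //=.
(* Pass to the predecessor of the return: it lies above [k], and one step descends by at most 1, so
   the return is at height exactly [k]. *)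
case: j lt_ij le_j hj above {min_j ltj} => // j lt_ij le_j hj above.
have [E|lt] : i = j :> nat \/ (i < j)%N by lia.
  by move: hj; rewrite -E hi1; lia.
have := above j; rewrite lt ltnSn => /(_ isT).
by case: (dyck_heightS x j le_j); lia.
Qed.

Lemma card_tunnels k x : #|tunnels k x| = #|upsteps k x|.
Proof.
rewrite -(card_in_imset (f := fst) (D := mem (tunnels k x))).
  apply: eq_card => i; apply/imsetP/idP; last first.
    by move=> /first_return[j t_ij]; exists (i, j).
  move=> [[i' j] /tunnelsP /= [lt_ij hi hj above] ->].
  have lt_i : (i' < n.*2)%N by have := ltn_ord j; lia.
  apply/upstepsP; split=> //.
  have [E|lt] : i'.+1 = j :> nat \/ (i'.+1 < j)%N by lia.
    by have := dyck_heightS x i' lt_i; rewrite E hi hj; lia.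
  have := above i'.+1; rewrite ltnSn lt => /(_ isT).
  by case: (dyck_heightS x i' lt_i); lia.
move=> [i j] [i' j'] /tunnelsP /= [lt_ij hi hj above] /tunnelsP /= [lt_ij' hi' hj' above'] /= E.
move: E lt_ij' above' => <- lt_ij' above'; congr pair; apply: val_inj => /=.
(* The smaller of two distinct right endpoints would lie inside the other tunnel, where the path is
   strictly above [k]. *)
have [lt|lt|//] := ssrnat.ltngtP (j : nat) (j' : nat).
  by have := above' j; rewrite lt_ij lt => /(_ isT); rewrite hj; lia.
by have := above j'; rewrite lt_ij' lt => /(_ isT); rewrite hj'; lia.
Qed.

Lemma height_joinE x y (i : nat) : (i <= n.*2)%N ->
  height (x `|` y)%O i = Num.max (height x i) (height y i).
Proof. exact: height_join. Qed.

Lemma height_meetE x y (i : nat) : (i <= n.*2)%N ->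
  height (x `&` y)%O i = Num.min (height x i) (height y i).
Proof. exact: height_meet. Qed.

Lemma card_upstepsE k x :
  #|upsteps k x| = (\sum_i (i \in upsteps k x))%N.
Proof. by rewrite -sum1_card big_mkcond; apply: eq_bigr => i _; case: ifP. Qed.

Lemma card_upsteps_modular k x y :
  (#|upsteps k (x `|` y)%O| + #|upsteps k (x `&` y)%O| =
   #|upsteps k x| + #|upsteps k y|)%N.
Proof.
rewrite !card_upstepsE -!big_split /=; apply: eq_bigr => i _; rewrite !inE.
case: ltnP => //= lt_i; have le_i := ltnW lt_i.
rewrite !height_joinE ?height_meetE //.
have [a ha] := dyck_parity x i le_i; have [b hb] := dyck_parity y i le_i.
have hx := dyck_heightS x i lt_i; have hy := dyck_heightS y i lt_i.
(* Equal parity makes the height difference even, so the paths cannot cross strictly inside a unit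
   interval. *)
have [le_xy|le_yx] : (height x i <= height y i /\ height x i.+1 <= height y i.+1) \/
    (height y i <= height x i /\ height y i.+1 <= height x i.+1) by lia.
  by case: le_xy => le0 le1; rewrite !max_r // !min_l // addnC.
by case: le_yx => le0 le1; rewrite !max_l // !min_r.
Qed.

Lemma height_bot (i : nat) : (i <= n.*2)%N ->
  height (\bot%O : dyck n) i = (odd i)%:Z.
Proof. exact: height_zigzag. Qed.

(** The zigzag only reaches heights 0 and 1, whereas such a step ends at height at least 2. *)
Lemma upsteps_bot k : 0 < k -> upsteps k (\bot%O : dyck n) = set0.
Proof.
move=> k0; apply/setP => i; rewrite in_set0; apply/negP => /upstepsP [lt_i _].
by rewrite height_bot //; case: (odd _) => /=; lia.
Qed.

Lemma upsteps1_neq0 x : x != \bot%O -> exists i, i \in upsteps 1 x.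
Proof.
move=> /eqP x_bot; apply: boolp.contrapT => none; apply: x_bot.
apply: dyck_inj => i le_i; rewrite height_bot //.
have [m E] := dyck_parity x i le_i; have ge0 := dyck_ge0 x le_i.
(* A height in {0, 1} is determined by the parity of the abscissa. *)
suff : height x i <= 1 by case: (odd _) (odd_double_half i) => /=; lia.
elim: i le_i {m E ge0} => [|i IH] lt_i; first by rewrite height0.
have {}IH := IH (ltnW lt_i); have ge0 := dyck_ge0 x (ltnW lt_i).
case: (dyck_heightS x i lt_i) => E; last by lia.
rewrite E; have [hi|] : height x i = 1 \/ height x i <= 0 by lia.
  case: none; exists (Ordinal (leqW lt_i)); apply/upstepsP; split=> //=.
  by rewrite E hi.
lia.
Qed.

Lemma upsteps1_uniq x i j : join_irreducible x ->
  i \in upsteps 1 x -> j \in upsteps 1 x -> (i < j)%N -> False.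
Proof.
move=> [_ irr_x] /upstepsP[lt_i hi hi1] /upstepsP[lt_j hj hj1] lt_ij.
(* Hence the zigzag also has height 1 at [j], and both gluings [hu] and [hv] below are continuous
   there. *)
have odd_j : odd j by have [m] := dyck_parity x j (ltnW lt_j); rewrite hj; lia.
pose hu l := if (l <= j)%N then height x l else (odd l)%:Z : int.
pose hv l := if (l <= j)%N then (odd l)%:Z : int else height x l.
have odd_end : odd n.*2 = false by rewrite odd_double.
have pu : @dyck_profile n hu.
  rewrite /hu; split=> [||l le_l|l lt_l]; first by rewrite leq0n height0.
  - by case: ifP => _; rewrite ?dyck_end ?odd_end.
  - by case: ifP => _; rewrite ?dyck_ge0.
  have := dyck_heightS x l lt_l; have [lt|lt|E] := ssrnat.ltngtP l j; rewrite //=.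
  + by case: (odd l) => /=; lia.
  + by rewrite E hj odd_j; lia.
have pv : @dyck_profile n hv.
  rewrite /hv; split=> [||l le_l|l lt_l]; first by rewrite leq0n.
  - by case: ifP => _; rewrite ?dyck_end ?odd_end.
  - by case: ifP => _; rewrite ?dyck_ge0.
  have := dyck_heightS x l lt_l; have [lt|lt|E] := ssrnat.ltngtP l j; rewrite //=.
  + by case: (odd l) => /=; lia.
  + by rewrite E hj odd_j; lia.
pose u := Dyck (is_dyck_steps_of pu); pose v := Dyck (is_dyck_steps_of pv).
have hE (l : nat) : (l <= n.*2)%N -> height u l = hu l /\ height v l = hv l.
  by move=> le_l; split; apply: height_steps_of.
(* At each abscissa one of [u], [v] agrees with [x] and the other with the zigzag, which lies below
   [x]. *)
have xE : x = (u `|` v)%O.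
  apply: dyck_inj => l le_l; rewrite height_joinE //.
  have [-> ->] := hE l le_l.
  have : height (\bot%O : dyck n) l <= height x l by apply: (elimT (dyck_leP _ _)) => //; apply: dyck_le0x.
  rewrite height_bot // /hu /hv; case: ifP => _; lia.
(* [x] has height 2 at [j.+1] and at [i.+1], but [u] is in its zigzag part at [j.+1], and [v] in its
   own at [i.+1], since [i < j]. *)
case: (irr_x u v xE) => E.
  have [+ _] := hE j.+1 lt_j; rewrite -E hj1 /hu ltnn /=; case: (~~ _); lia.
have [_ +] := hE i.+1 lt_i; rewrite -E hi1 /hv lt_ij /=; case: (~~ _); lia.
Qed.

Lemma card_upsteps1_irr x : join_irreducible x -> #|upsteps 1 x| = 1%N.
Proof.
move=> irr_x; have [i ui] := upsteps1_neq0 x (proj1 irr_x).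
apply/eqP/cards1P; exists i; apply/setP => j; rewrite in_set1.
apply/idP/eqP => [uj|-> //]; apply: val_inj.
by have [/upsteps1_uniq|/upsteps1_uniq|//] := ssrnat.ltngtP (val j) (val i); case/(_ _ irr_x).
Qed.

End UpSteps.

Theorem theorem3p18 (R : realType) (n : nat) (x : dyck n) :
  euler_char R x = #|tunnels 1 x|%:R.
Proof.
apply/esym; apply: (euler_char_unique (nu := fun x : dyck n => #|tunnels 1 x|%:R)).
split; last by move=> y irr_y; rewrite card_tunnels card_upsteps1_irr.
split; first by rewrite card_tunnels upsteps_bot // cards0.
by move=> y z; rewrite !card_tunnels -!natrD card_upsteps_modular.
Qed.
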